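(* For $u>0$, $v\ge 0$ let $\Gamma(u,v)=\int_v^\infty x^{u-1}e^{-x}\,dx$, and for $c>0$ let $\mathcal{R}_c(u,v)=\Gamma(c+u,v)/\Gamma(u,v)$. (i) For fixed $v\ge 0$, the function $(c,u)\mapsto\mathcal{R}_c(u,v)$, $c>0$, $u>0$, is $\mathrm{STP}_\infty$. (ii) For fixed $u>0$, the function $(c,v)\mapsto\mathcal{R}_c(u,v)$, $c>0$, $v\ge 0$, is $\mathrm{STP}_\infty$. (iii) For fixed $c>0$, the function $(u,v)\mapsto\mathcal{R}_c(u,v)$, $u>0$, $v\ge 0$, is $\mathrm{SRR}_2$.
   Context: Let $K(a,b)$ be a real function on a product $A\times B$ of subsets of $\mathbb{R}$. $K$ is $\mathrm{STP}_\infty$ (strictly totally positive of order infinity) if for every $r\ge 1$, all $a_1>\cdots>a_r$ in $A$ and all $b_1>\cdots>b_r$ in $B$, the $r\times r$ determinant $\det(K(a_i,b_j))$ is $>0$. $K$ is $\mathrm{SRR}_2$ (strictly reverse-rule of order 2) if $(-1)^{r(r-1)/2}\det(K(a_i,b_j))_{r\times r}>0$ for $r=1,2$ and all such decreasing sequences; that is, $K>0$ and $K(a_1,b_1)K(a_2,b_2)<K(a_1,b_2)K(a_2,b_1)$ whenever $a_1>a_2$, $b_1>b_2$. *)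

(* Defs.v *)
From HB Require Import structures.
From mathcomp Require Import all_boot all_order all_algebra.
From mathcomp Require Import all_classical all_reals all_analysis.

Set Implicit Arguments.
Unset Strict Implicit.
Unset Printing Implicit Defensive.

Import Order.TTheory GRing.Theory Num.Theory.
Import numFieldNormedType.Exports.

Local Open Scope classical_set_scope.
Local Open Scope ring_scope.

Definition decreasing_in (R : realType) (A : set R) (r : nat) (a : 'I_r -> R) :=
  (forall i, A (a i)) /\ (forall i j : 'I_r, (i < j)%N -> a j < a i).

Definition STP_infty (R : realType) (A B : set R) (K : R -> R -> R) : Prop :=
  forall (r : nat) (a b : 'I_r -> R), (1 <= r)%N ->
    decreasing_in A a -> decreasing_in B b ->
    0 < \det (\matrix_(i < r, j < r) K (a i) (b j)).

Definition SRR (k : nat) (R : realType) (A B : set R) (K : R -> R -> R) : Prop :=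
  forall (r : nat) (a b : 'I_r -> R), (1 <= r <= k)%N ->
    decreasing_in A a -> decreasing_in B b ->
    0 < (-1) ^+ ((r * (r - 1)) %/ 2)%N
        * \det (\matrix_(i < r, j < r) K (a i) (b j)).

(* Real-valued Lebesgue integral: it is a junk 0 where the extended-real
   integral is infinite, which never happens for 0 < u and 0 <= v.  For v = 0
   and u < 1, [powR] takes a junk value at x = 0, on a set of measure zero. *)
Definition upper_incomplete_gamma (R : realType) (u v : R) : R :=
  \int[@lebesgue_measure R]_(x in `[v, +oo[) (x `^ (u - 1) * expR (- x)).

Definition gamma_ratio (R : realType) (c u v : R) : R :=
  upper_incomplete_gamma (c + u) v / upper_incomplete_gamma u v.

(* Main.v *)
Require Import Defs.
From HB Require Import structures.
From mathcomp Require Import all_boot all_order all_algebra perm.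
From mathcomp Require Import all_classical all_reals all_analysis.
From mathcomp Require Import measurable_realfun ring lra.

Set Implicit Arguments.
Unset Strict Implicit.
Unset Printing Implicit Defensive.

Import Order.TTheory GRing.Theory Num.Theory.
Import numFieldNormedType.Exports.

Local Open Scope classical_set_scope.
Local Open Scope ring_scope.

(** Write G u v for the upper incomplete gamma function.  As a function of v it
    is a "tail": it tends to 0 at infinity and its derivative is minus a weight,
    so a linear combination of such functions is positive as soon as the same
    combination of the weights is positive off a finite set.

    (i), (ii): dividing the columns by G (u_j) v or G u (v_j) leaves a
    determinant of tails.  It is multilinear in its columns (in (i): in the r
    copies of the matrix occurring in Andreief's expansion of r! times the
    determinant), so the tails may be replaced one at a time by point
    evaluations of the weights; this reduces positivity to that of the
    generalised Vandermonde determinant det (x_j ^ c_i) without any multiple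
    integral.  The Vandermonde determinant is treated by the same replacement
    argument, with the mean value theorem in place of tails.

    (iii): the v-derivative of the logarithm of
    G (c+u1) v * G u2 v / (G (c+u2) v * G u1 v) is negative iff the second
    difference of the hazard rate u |-> v ^ (u-1) * exp (-v) / G u v is
    positive.  This follows from (1 - v ^ c * G a v / G (c+a) v) / c being
    decreasing in c, which is Chebyshev's inequality for the increasing powers
    of x and the decreasing Mills ratio G a x / (x ^ a * exp (-x)). *)

(** * Multilinear forms and positivity of determinants *)

Definition upd (T : Type) (r : nat) (N : 'I_r -> T) (k : 'I_r) (u : T) :
    'I_r -> T :=
  fun i => if i == k then u else N i.

(* The slots are switched from [gam (x k)] to [w k] starting from the last one;
   hence the points [adm k x] admissible in slot [k] may depend on [x] only
   through the earlier slots. *)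
Lemma multilinear_hull_gt0 (R : realType) (V : lmodType R) (r : nat)
    (Phi : ('I_r -> V) -> R) (gam : R -> V) (w : 'I_r -> V)
    (adm : 'I_r -> ('I_r -> R) -> R -> Prop) :
  (forall N k a u v,
     Phi (upd N k (a *: u + v)) = a * Phi (upd N k u) + Phi (upd N k v)) ->
  (forall (k : 'I_r) x y t, (forall j : 'I_r, (j < k)%N -> x j = y j) ->
     adm k x t -> adm k y t) ->
  (forall k x (l : {scalar V}), (forall t, adm k x t -> 0 < l (gam t)) ->
     0 < l (w k)) ->
  (forall x, (forall k, adm k x (x k)) -> 0 < Phi (fun i => gam (x i))) ->
  0 < Phi w.
Proof.
move=> Plin admE hull pos.
have step m x : (m <= r)%N ->
    (forall k : 'I_r, (k < r - m)%N -> adm k x (x k)) ->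
    0 < Phi (fun i : 'I_r => if (i < r - m)%N then gam (x i) else w i).
  elim: m x => [|m IH] x mr xadm.
    have -> : (fun i : 'I_r => if (i < r - 0)%N then gam (x i) else w i)
        = fun i => gam (x i) by apply: funext => i; rewrite subn0 ltn_ord.
    by apply: pos => k; apply: xadm; rewrite subn0.
  have km : (r - m.+1 < r)%N by rewrite -subSn // subSS leq_subr.
  pose k := Ordinal km.
  have rm : (r - m)%N = (r - m.+1).+1 by rewrite -subSn.
  set N := fun i : 'I_r => _.
  (* With the other slots frozen, [Phi] is a linear form in slot [k], so [hull] carries its
     positivity from the admissible [gam t] to [w k]. *)
  pose l0 u := Phi (upd N k u).
  pose L := GRing.isLinear.Build R V R *%R l0 (fun a u v => Plin N k a u v).
  pose l : {scalar V} := HB.pack l0 L.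
  have -> : N = upd N k (w k).
    apply: funext => i; rewrite /upd /N; case: eqP => // ->.
    by rewrite ltnn.
  apply: (hull k x l) => t tadm; rewrite /l /= /l0.
  pose y := upd x k t.
  have yE (j : 'I_r) : (j < k)%N -> x j = y j.
    by rewrite /y /upd; case: eqP => // ->; rewrite ltnn.
  suff -> : upd N k (gam t) =
      fun i : 'I_r => if (i < r - m)%N then gam (y i) else w i.
    apply: IH; first exact: ltnW.
    move=> j; rewrite rm ltnS leq_eqVlt => /orP[/eqP jk|jk].
      have -> : j = k by apply: val_inj.
      by apply: (admE _ x) => //; rewrite /y /upd eqxx.
    rewrite -(yE j jk); apply: (admE _ x); last exact: xadm.
    by move=> i ij; apply: yE; apply: ltn_trans ij jk.
  apply: funext => i; rewrite /upd /N /y /upd.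
  have [->|ik] := eqVneq i k; first by rewrite /= rm ltnSn.
  by rewrite rm ltnS [in RHS]leq_eqVlt (negPf (ik : nat_of_ord i != (r - m.+1)%N)).
have := step r (fun=> 0) (leqnn _); rewrite subnn => /(_ _); apply.
by [].
Qed.

Lemma scalar_mx_sum (R : realType) (m n : nat) (l : {scalar 'M[R]_(m, n)})
  (A : 'M[R]_(m, n)) : l A = \sum_(i < m) \sum_(j < n) l (delta_mx i j) * A i j.
Proof.
rewrite {1}(matrix_sum_delta A) linear_sum; apply: eq_bigr => i _.
by rewrite linear_sum; apply: eq_bigr => j _; rewrite linearZ /= mulrC.
Qed.

(** The determinant is linear in each row; here the points allowed in one row do not depend on those
    chosen in the others. *)
Lemma det_rows_hull_gt0 (R : realType) (r : nat) (gam : R -> 'rV[R]_r)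
    (w : 'I_r -> 'rV[R]_r) (I : 'I_r -> R -> Prop) :
  (forall k (l : {scalar 'rV[R]_r}), (forall t, I k t -> 0 < l (gam t)) ->
     0 < l (w k)) ->
  (forall x : 'I_r -> R, (forall k, I k (x k)) ->
     0 < \det (\matrix_(k < r) gam (x k))) ->
  0 < \det (\matrix_(k < r) w k).
Proof.
move=> hull pos.
apply: (@multilinear_hull_gt0 R _ r (fun N => \det (\matrix_(k < r) N k)) gam w
  (fun k _ t => I k t)) => //; last by move=> k _ l; apply: hull.
move=> N k a u v; rewrite -[X in _ = _ + X]mul1r.
apply: (determinant_multilinear (i0 := k)).
- by apply/rowP => j; rewrite !mxE /upd !eqxx !mxE mul1r.
- by apply/matrixP => i j; rewrite !mxE /upd eq_sym (negPf (neq_lift _ _)).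
- by apply/matrixP => i j; rewrite !mxE /upd eq_sym (negPf (neq_lift _ _)).
Qed.

(** The double Leibniz sum of Andreief's identity, with its own matrix in each of the [r] factors so
    that it is linear in each of them. *)
Definition leibniz2 (R : realType) (r : nat) (N : 'I_r -> 'M[R]_r) : R :=
  \sum_(s : 'S_r) \sum_(t : 'S_r)
    (-1) ^+ s * (-1) ^+ t * \prod_k N k (s k) (t k).

(** For fixed [s], the sum over [t] is the determinant of [M] with rows permuted by [s], whose sign
    cancels against [(-1) ^+ s]. *)
Lemma leibniz2_const (R : realType) (r : nat) (M : 'M[R]_r) :
  leibniz2 (fun=> M) = r`!%:R * \det M.
Proof.
rewrite /leibniz2.
transitivity (\sum_(s : 'S_r) \det M).
  apply: eq_bigr => s _.
  have := det_mulmx (perm_mx s) M; rewrite -row_permE det_perm => dE.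
  transitivity ((-1) ^+ s * \det (row_perm s M)).
    rewrite /determinant mulr_sumr; apply: eq_bigr => t _; rewrite mulrA.
    by congr (_ * _); apply: eq_bigr => k _; rewrite mxE.
  by rewrite dE mulrA -expr2 sqrr_sign mul1r.
by rewrite sumr_const card_Sn mulr_natl.
Qed.

Lemma leibniz2_rank1 (R : realType) (r : nat) (p q : 'I_r -> 'I_r -> R) :
  leibniz2 (fun k => \matrix_(i < r, j < r) (p k i * q k j)) =
  \det (\matrix_(k < r, i < r) p k i) * \det (\matrix_(k < r, i < r) q k i).
Proof.
rewrite /leibniz2 /determinant mulr_suml; apply: eq_bigr => s _.
rewrite mulr_sumr; apply: eq_bigr => t _.
rewrite mulrACA -big_split /=; congr (_ * _).
by apply: eq_bigr => k _; rewrite !mxE.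
Qed.

Lemma leibniz2_linear (R : realType) (r : nat) (N : 'I_r -> 'M[R]_r) k a u v :
  leibniz2 (upd N k (a *: u + v)) =
  a * leibniz2 (upd N k u) + leibniz2 (upd N k v).
Proof.
rewrite /leibniz2 mulr_sumr -big_split; apply: eq_bigr => s _ /=.
rewrite mulr_sumr -big_split; apply: eq_bigr => t _ /=.
have prodE z : \prod_i upd N k z i (s i) (t i) =
    z (s k) (t k) * \prod_(i | i != k) N i (s i) (t i).
  rewrite (bigD1 k) //= /upd eqxx; congr (_ * _).
  by apply: eq_bigr => i /negPf ->.
by rewrite !prodE !mxE mulrDl mulrDr !mulrA -(mulrC a) !mulrA.
Qed.

(* The basic composition formula: [M] stands for the integral of the rank one
   matrices [p i t * q j t].  Integrating one variable at a time turns
   [leibniz2_rank1] into [leibniz2_const], so Fubini is not needed. *)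
Lemma andreief_det_gt0 (R : realType) (r : nat) (p q : 'I_r -> R -> R)
    (M : 'M[R]_r) (X : set R) :
  (forall (s : seq R) (l : {scalar 'M[R]_r}),
     (forall t, X t -> t \notin s -> 0 < l (\matrix_(i, j) (p i t * q j t))) ->
     0 < l M) ->
  (forall x : 'I_r -> R, injective x -> (forall k, X (x k)) ->
     0 < \det (\matrix_(k < r, i < r) p i (x k))
         * \det (\matrix_(k < r, i < r) q i (x k))) ->
  0 < \det M.
Proof.
move=> hull pos.
have : 0 < leibniz2 (fun=> M).
  apply: (@multilinear_hull_gt0 R _ r (@leibniz2 R r)
    (fun t => \matrix_(i, j) (p i t * q j t)) (fun=> M)
    (* Avoiding the earlier points makes [x] injective, without which the rank one value would
       vanish; the hull condition allows finitely many points to be discarded. *)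
    (fun (k : 'I_r) x t => X t /\ forall j : 'I_r, (j < k)%N -> x j != t)).
  - exact: leibniz2_linear.
  - by move=> k x y t xy [Xt xt]; split=> // j jk; rewrite -xy // xt.
  - move=> k x l lpos; apply: (hull [seq x j | j <- enum 'I_r]) => t Xt ts.
    apply: lpos; split=> // j _; apply: contraNneq ts => <-.
    by apply/mapP; exists j; rewrite ?mem_enum.
  - move=> x xadm; rewrite leibniz2_rank1; apply: pos => [i j xij|k].
      apply: val_inj; apply/eqP; case: ltngtP => // ij.
        by have [_ /(_ _ ij)] := xadm j; rewrite xij eqxx.
      by have [_ /(_ _ ij)] := xadm i; rewrite xij eqxx.
    by have [] := xadm k.
by rewrite leibniz2_const pmulr_rgt0 // ltr0n fact_gt0.
Qed.

(** * Tails *)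

(** The interval is cut at the points of [s] inside it, and the mean value theorem is applied to
    each piece. *)
Lemma decr_off_seq (R : realType) (f df : R -> R) (s : seq R) (a b : R) :
  a < b -> {within `[a, b], continuous f} ->
  (forall x, a < x < b -> x \notin s -> is_derive x 1 f (df x) /\ df x < 0) ->
  f b < f a.
Proof.
elim: s a b => [|z s IH] a b ab fc fd.
  have [|c /[!in_itv]/= cab fE] := @MVT R f df a b ab _ fc.
    by move=> x /[!in_itv]/= xab; have [] := fd x xab.
  rewrite -subr_lt0 fE pmulr_llt0 ?subr_gt0 //.
  by have [] := fd c cab.
have [zab|zab] := boolP (a < z < b).
  move: (zab) => /andP[az zb].
  apply: (@lt_trans _ _ (f z)).
    apply: IH => //; first by
      apply: continuous_subspaceW fc; apply: subset_itvr; rewrite bnd_simp ltW.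
    move=> x /andP[zx xb] xs; apply: fd; rewrite ?xb ?(lt_trans az zx) //.
    by rewrite inE negb_or xs gt_eqF.
  apply: IH => //; first by
    apply: continuous_subspaceW fc; apply: subset_itvl; rewrite bnd_simp ltW.
  move=> x /andP[ax xz] xs; apply: fd; rewrite ?ax ?(lt_trans xz zb) //.
  by rewrite inE negb_or xs lt_eqF.
apply: IH => // x xab xs; apply: fd => //; rewrite inE negb_or xs andbT.
by apply: contraNneq zab => <-.
Qed.

Lemma is_derive_continuous (R : realType) (f : R -> R) (x d : R) :
  is_derive x 1 f d -> {for x, continuous f}.
Proof.
move=> fd; apply/differentiable_continuous.
by rewrite -derivable1_diffP; exact: ex_derive.
Qed.

(** The derivative is prescribed only to the right of [v]: for [v = 0] and [u < 1] the gamma weight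
    is unbounded near 0. *)
Definition tail_of (R : realType) (v : R) (phi F : R -> R) :=
  [/\ forall b, v < b -> {within `[v, b], continuous F},
      forall x, v < x -> is_derive x 1 F (- phi x) &
      F x @[x --> +oo] --> 0].

Section tail_theory.
Variable R : realType.
Implicit Types (v a b : R) (phi psi F G : R -> R) (s : seq R).

Lemma tail_ofW v w phi F : v <= w -> tail_of v phi F -> tail_of w phi F.
Proof.
move=> vw [Fc Fd F0]; split=> // [b wb|x wx].
  apply: continuous_subspaceW (Fc b (le_lt_trans vw wb)).
  by apply: subset_itvr; rewrite bnd_simp.
by apply: Fd; exact: le_lt_trans wx.
Qed.

Lemma tail_of_open v phi F : (forall x, v <= x -> is_derive x 1 F (- phi x)) ->
  F x @[x --> +oo] --> 0 -> tail_of v phi F.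
Proof.
move=> Fd F0; split=> // [b vb|x vx]; last by apply: Fd; exact: ltW.
apply: derivable_within_continuous => x /[!in_itv]/= /andP[vx _].
by have [] := Fd x vx.
Qed.

Lemma eq_tail_of v phi psi F : (forall x, v < x -> phi x = psi x) ->
  tail_of v phi F -> tail_of v psi F.
Proof. by move=> pE [Fc Fd F0]; split=> // x vx; rewrite -pE //; exact: Fd. Qed.

Lemma tail_of_decr v a b s phi F : tail_of v phi F -> v <= a -> a < b ->
  (forall x, a < x < b -> x \notin s -> 0 < phi x) -> F b < F a.
Proof.
move=> Ft va ab pos; have [Fc Fd _] := tail_ofW va Ft.
apply: (@decr_off_seq _ _ (fun x => - phi x) s) => //; first exact: Fc.
by move=> x axb xs; rewrite oppr_lt0; split; [apply: Fd; case/andP: axb|exact: pos].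
Qed.

(** The limit at infinity gives only [0 <= F (a + 1)]; the strict decrease from [a] to [a + 1]
    supplies strictness. *)
Lemma tail_of_gt0 v a s phi F : tail_of v phi F -> v <= a ->
  (forall x, a < x -> x \notin s -> 0 < phi x) -> 0 < F a.
Proof.
move=> Ft va pos; have [_ _ F0] := Ft.
have a1 : a < a + 1 by rewrite ltrDl.
have posb b y : a < y < b -> y \notin s -> 0 < phi y.
  by move=> /andP[ay _]; exact: pos.
apply: le_lt_trans (tail_of_decr Ft va a1 (posb _)).
rewrite -(cvg_lim (@Rhausdorff R) F0); apply: limr_le; first by apply: cvgP F0.
near=> x; apply/ltW/(tail_of_decr (s := s) Ft).
- by rewrite (le_trans va) // ltW.
- by near: x; apply: nbhs_pinfty_gt; rewrite num_real.
- by move=> y /andP[xy _]; apply: pos; exact: lt_trans xy.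
Unshelve. all: by end_near. Qed.

Lemma tail_ofD v phi psi F G : tail_of v phi F -> tail_of v psi G ->
  tail_of v (fun x => phi x + psi x) (fun x => F x + G x).
Proof.
move=> [Fc Fd F0] [Gc Gd G0]; split=> [b vb|x vx|].
- by move=> x; apply: cvgD; [exact: Fc|exact: Gc].
- rewrite opprD.
  have := Fd x vx; have := Gd x vx => ? ?.
  exact: is_deriveD.
- by rewrite -[X in _ --> X]addr0; exact: cvgD.
Qed.

Lemma tail_ofZ v k phi F : tail_of v phi F ->
  tail_of v (fun x => k * phi x) (fun x => k * F x).
Proof.
move=> [Fc Fd F0]; split=> [b vb|x vx|].
- by move=> x; apply: cvgM; [exact: cvg_cst|exact: Fc].
- have := Fd x vx => ?; rewrite -mulrN.
  exact: is_deriveZ.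
- by rewrite -[X in _ --> X](mulr0 k); apply: cvgM => //; exact: cvg_cst.
Qed.

Lemma tail_of0 v : tail_of v (fun=> 0) (fun=> 0).
Proof.
split=> [b vb|x vx|]; first by move=> x; exact: cvg_cst.
  by rewrite oppr0; exact: is_derive_cst.
exact: cvg_cst.
Qed.

Lemma tail_of_sum v (I : Type) (r : seq I) (phi F : I -> R -> R) :
  (forall i, tail_of v (phi i) (F i)) ->
  tail_of v (fun x => \sum_(i <- r) phi i x) (fun x => \sum_(i <- r) F i x).
Proof.
move=> Ft; elim: r => [|i r IH].
  under eq_fun do rewrite big_nil.
  under [X in tail_of _ _ X]eq_fun do rewrite big_nil.
  exact: tail_of0.
under eq_fun do rewrite big_cons.
under [X in tail_of _ _ X]eq_fun do rewrite big_cons.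
exact: tail_ofD.
Qed.

(** A linear form on matrices is a finite combination of entries. This is how the hull hypotheses
    are met for matrices of incomplete gamma functions. *)
Lemma tail_of_mx v (m n : nat) (l : {scalar 'M[R]_(m, n)})
    (phi F : 'I_m -> 'I_n -> R -> R) :
  (forall i j, tail_of v (phi i j) (F i j)) ->
  tail_of v (fun x => l (\matrix_(i, j) phi i j x))
    (fun x => l (\matrix_(i, j) F i j x)).
Proof.
move=> Ft.
have lE (H : 'I_m -> 'I_n -> R -> R) : (fun x => l (\matrix_(i, j) H i j x)) =
    fun x => \sum_i \sum_j l (delta_mx i j) * H i j x.
  apply: funext => x; rewrite scalar_mx_sum; apply: eq_bigr => i _.
  by apply: eq_bigr => j _; rewrite mxE.
by rewrite !lE; do 2![apply: tail_of_sum => ?]; exact: tail_ofZ.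
Qed.

End tail_theory.

(** * The upper incomplete gamma function as a tail *)

Section gamma.
Variable R : realType.
Implicit Types u v a b c x : R.
Notation mu := (@lebesgue_measure R).

Definition gammaw u x : R := x `^ (u - 1) * expR (- x).

Lemma gammaw_gt0 u x : 0 < x -> 0 < gammaw u x.
Proof. by move=> x0; rewrite mulr_gt0 ?powR_gt0 ?expR_gt0. Qed.

Lemma gammaw_ge0 u x : 0 <= gammaw u x.
Proof. by rewrite mulr_ge0 ?powR_ge0 ?expR_ge0. Qed.

(** For x = 2uy the bound becomes y^u <= exp(uy), which is ln y <= y. *)
Lemma powR_le_expR_half u x : 0 < u -> 0 < x ->
  x `^ u <= (2 * u) `^ u * expR (x / 2).
Proof.
move=> u0 x0; have u20 : 0 < 2 * u by rewrite mulr_gt0.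
have [y y0 ->] : exists2 y, 0 < y & x = 2 * u * y.
  by exists (x / (2 * u)); rewrite ?divr_gt0 // mulrC divfK ?gt_eqF.
rewrite powRM ?(ltW y0) ?(ltW u20) // ler_wpM2l ?powR_ge0 //.
rewrite {1}/powR gt_eqF // ler_expR (_ : 2 * u * y / 2 = u * y); last by field.
by rewrite ler_pM2l // ltW // ln_sublinear.
Qed.

Lemma powR_sqr_le_expR u : 0 < u ->
  exists2 C : R, 0 < C & forall x, 0 < x -> (1 + x `^ u) ^+ 2 <= C * expR x.
Proof.
move=> u0; exists ((1 + (2 * u) `^ u) ^+ 2) => [|x x0].
  by rewrite exprn_gt0 // ltr_pwDl ?ltr01 // powR_ge0.
have -> : expR x = expR (x / 2) ^+ 2 by rewrite -expRM_natr divfK ?pnatr_eq0.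
rewrite -exprMn lerXn2r ?nnegrE ?addr_ge0 ?mulr_ge0 ?powR_ge0 ?expR_ge0 //.
  by rewrite addr_ge0 ?powR_ge0.
rewrite mulrDl mul1r lerD ?powR_le_expR_half //.
by rewrite -expR0 ler_expR divr_ge0 // ltW.
Qed.

Lemma cvgy_powR u : 0 < u -> x `^ u @[x --> +oo] --> +oo.
Proof.
move=> u0; apply/cvgryPge => A.
near=> x.
have A1 : 0 < Num.max A 1 by rewrite lt_max ltr01 orbT.
apply: (@le_trans _ _ (Num.max A 1)); first by rewrite le_max lexx.
rewrite -[leLHS](powRr1 (ltW A1)) -[X in _ `^ X](mulVf (lt0r_neq0 u0)) powRrM.
rewrite ge0_ler_powR ?nnegrE ?powR_ge0 ?(ltW u0) //.
Unshelve. all: by end_near. Qed.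

(* Up to a constant, [- powR_bump u] is a primitive of a majorant of [gammaw u]
   that is integrable both at 0 and at infinity. *)
Definition powR_bump u x : R := (1 + x `^ u)^-1.

Lemma powR_bump_gt0 u x : 0 < powR_bump u x.
Proof. by rewrite invr_gt0 ltr_pwDl ?ltr01 // powR_ge0. Qed.

Lemma is_derive_powR_bump u x : 0 < x ->
  is_derive x 1 (powR_bump u) (- (u * x `^ (u - 1) / (1 + x `^ u) ^+ 2)).
Proof.
move=> x0; have p0 : 1 + x `^ u != 0.
  by rewrite gt_eqF // ltr_pwDl ?ltr01 // powR_ge0.
have dp := @is_derive1_powR R u x x0.
have d1 : is_derive x 1 (fun y => 1 + y `^ u) (u * x `^ (u - 1)).
  by have := is_deriveD (is_derive_cst (1 : R) x 1) dp; rewrite add0r.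
apply: DeriveDef; first by apply: derivableV => //; exact: ex_derive.
rewrite (@deriveV _ _ (fun y => 1 + y `^ u)) //.
by rewrite (@derive_val _ _ _ _ _ _ _ d1) /GRing.scale /= mulNr mulrC.
Qed.

Lemma cvgy_powR_bump u : 0 < u -> powR_bump u x @[x --> +oo] --> 0.
Proof.
move=> u0; apply/(@gtr0_cvgV0 _ _ _ _ (fun x => 1 + x `^ u)).
  by near=> x; rewrite ltr_pwDl ?ltr01 // powR_ge0.
apply/cvgryPge => A; near=> x.
apply: (@le_trans _ _ (x `^ u)); last by rewrite lerDr.
by near: x; move: A; apply/cvgryPge; exact: cvgy_powR.
Unshelve. all: by end_near. Qed.


Lemma continuous_gammaw u x : 0 < x -> {for x, continuous (gammaw u)}.
Proof.
move=> x0; apply: cvgM.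
  exact: is_derive_continuous (is_derive1_powR (u - 1) x0).
apply: continuous_comp; first exact: opp_continuous.
exact: continuous_expR.
Qed.

Lemma measurable_gammaw u (D : set R) : measurable_fun D (gammaw u).
Proof.
apply: measurable_funTS; apply: measurable_funM => //.
exact: measurableT_comp.
Qed.

Definition bump_density u x : R := u * x `^ (u - 1) / (1 + x `^ u) ^+ 2.

Lemma bump_density_ge0 u x : 0 <= u -> 0 <= bump_density u x.
Proof. by move=> u0; rewrite divr_ge0 ?sqr_ge0 // mulr_ge0 ?powR_ge0. Qed.

Lemma within_continuous_bump_density u a : 0 < a ->
  {within `[a, +oo[, continuous (bump_density u)}.
Proof.
move=> a0.
apply: continuous_in_subspaceT => x /[!inE]/= /[!in_itv]/= /andP[ax _].
have x0 : 0 < x by exact: lt_le_trans ax.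
have cp p : {for x, continuous (@powR R ^~ p)}.
  exact: is_derive_continuous (is_derive1_powR p x0).
apply: cvgM; first by apply: cvgM => //; [exact: cvg_cst|exact: cp].
apply: cvgV; first by rewrite expf_neq0 // gt_eqF // ltr_pwDl ?ltr01 // powR_ge0.
have c1 : {for x, continuous (fun y => 1 + y `^ u)}.
  by apply: cvgD; [exact: cvg_cst|exact: cp].
by under eq_fun do rewrite expr2; exact: cvgM.
Qed.

Lemma ge0_integral_bump_density u a : 0 < u -> 0 < a ->
  (\int[mu]_(x in `[a, +oo[) (bump_density u x)%:E = (powR_bump u a)%:E)%E.
Proof.
move=> u0 a0; have db x := @is_derive_powR_bump u x.
have dF x : 0 < x -> is_derive x 1 (fun y => - powR_bump u y) (bump_density u x).
  by move=> x0; rewrite -[bump_density u x]opprK; apply: is_deriveN; exact: db.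
rewrite (@ge0_continuous_FTC2y _ (bump_density u) (fun y => - powR_bump u y) _ 0).
- by rewrite EFinN oppeK add0e.
- by move=> x _; rewrite bump_density_ge0 ?ltW.
- exact: within_continuous_bump_density.
- by rewrite -oppr0; apply: cvgN; exact: cvgy_powR_bump.
- by move=> x ax; have [] := dF x (lt_trans a0 ax).
- apply: cvg_at_right_filter; exact: is_derive_continuous (dF a a0).
- move=> x /[!in_itv]/= /andP[ax _].
  by rewrite derive1E; exact: (@derive_val _ _ _ _ _ _ _ (dF x (lt_trans a0 ax))).
Qed.

(** The bound (1 + x^u)^2 <= C exp(x) makes [gammaw u] at most [C / u] times [bump_density u], whose
    integral is known. *)
Lemma gamma_tail_le u : 0 < u -> exists2 C : R, 0 < C & forall a, 0 < a ->
  (\int[mu]_(x in `[a, +oo[) (gammaw u x)%:E <= (C * powR_bump u a)%:E)%E.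
Proof.
move=> u0; have [C C0 HC] := powR_sqr_le_expR u0.
exists (C / u) => [|a a0]; first by rewrite divr_gt0.
have Cu0 : 0 <= C / u by rewrite divr_ge0 // ltW.
have mb : measurable_fun `[a, +oo[ (bump_density u).
  apply: subspace_continuous_measurable_fun => //.
  exact: within_continuous_bump_density.
rewrite EFinM -ge0_integral_bump_density // -ge0_integralZl_EFin //=; last 2 first.
- by move=> x _; rewrite lee_fin bump_density_ge0 ?ltW.
- exact/measurable_EFinP.
apply: ge0_le_integral => //=.
- by move=> x _; rewrite lee_fin gammaw_ge0.
- by apply/measurable_EFinP; exact: measurable_gammaw.
- apply/measurable_EFinP; apply: measurable_funM => //.
- move=> x; rewrite in_itv/= andbT => ax.
  have x0 : 0 < x by exact: lt_le_trans ax.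
  have p0 : 0 < 1 + x `^ u by rewrite ltr_pwDl ?ltr01 // powR_ge0.
  rewrite lee_fin /gammaw /bump_density expRN.
  have -> : C / u * (u * x `^ (u - 1) / (1 + x `^ u) ^+ 2) =
      x `^ (u - 1) * (C / (1 + x `^ u) ^+ 2) by field; rewrite !gt_eqF.
  rewrite ler_wpM2l ?powR_ge0 // ler_pdivlMr ?exprn_gt0 // mulrC.
  by rewrite ler_pdivrMr ?expR_gt0 // HC.
Qed.

(** As [powR_bump u] never exceeds 1, the bound of [gamma_tail_le] is uniform in [a]; monotone
    convergence lets [a] tend to 0. *)
Lemma integrable_gammaw u : 0 < u ->
  mu.-integrable `[0, +oo[ (EFin \o gammaw u).
Proof.
move=> u0; have [C C0 HC] := gamma_tail_le u0.
have mg (D : set R) : measurable_fun D (fun x => (gammaw u x)%:E).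
  by apply/measurable_EFinP; exact: measurable_gammaw.
apply/integrableP; split; first exact: mg.
under eq_integral do rewrite /= ger0_norm ?gammaw_ge0 //.
rewrite -integral_itv_obnd_cbnd //.
apply: (@le_lt_trans _ _ C%:E); last exact: ltry.
pose F (n : nat) := `[n.+1%:R^-1 : R, +oo[%classic.
have -> : `]0 : R, +oo[%classic = \bigcup_n F n.
  apply/seteqP; split=> x /=; rewrite !in_itv/= !andbT.
    move=> x0; exists (Num.truncn (x^-1)) => //; rewrite /F /= in_itv/= andbT.
    by rewrite invf_ple ?posrE // ltW // truncnS_gt.
  by move=> [n _]; rewrite /F /= in_itv/= andbT; apply: lt_le_trans; rewrite invr_gt0.
have Fcvg : (\int[mu]_(x in F i) (gammaw u x)%:E @[i --> \oo] -->
    \int[mu]_(x in \bigcup_i F i) (gammaw u x)%:E)%E.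
  apply: ge0_nondecreasing_set_cvg_integral.
  - move=> m n mn; rewrite subsetEset => x; rewrite /F /= !in_itv/= !andbT.
    by apply: le_trans; rewrite lef_pV2 ?posrE // ler_nat ltnS.
  - by move=> n; exact: measurable_itv.
  - by move=> n; exact: mg.
  - by move=> n x _; rewrite lee_fin gammaw_ge0.
rewrite -(cvg_lim _ Fcvg) //; apply: lime_le; first exact: cvgP Fcvg.
apply: nearW => n; apply: le_trans (HC _ _) _; first by rewrite invr_gt0.
rewrite lee_fin ler_piMr ?(ltW C0) // invf_le1 ?ler_wpDr ?powR_ge0 //.
Qed.


Lemma upper_incomplete_gammaE u v x : 0 < u -> 0 <= v -> v <= x ->
  upper_incomplete_gamma u x = upper_incomplete_gamma u v -
    \int[mu]_(t in `[v, x]) gammaw u t.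
Proof.
move=> u0 v0 vx; have gi := integrable_gammaw u0.
have giv w : 0 <= w -> mu.-integrable `[w, +oo[ (EFin \o gammaw u).
  by move=> w0; apply: integrableS gi => //; apply: subset_itvr; rewrite bnd_simp.
rewrite [X in _ = X - _](_ : _ = \int[mu]_(t in `[v, +oo[) gammaw u t) //.
rewrite (Rintegral_itvB (giv v v0)) ?bnd_simp //.
rewrite Rintegral_itv_obnd_cbnd //.
apply: integrableS (giv x (le_trans v0 vx)) => //.
by apply: subset_itvr; rewrite bnd_simp.
Qed.

Lemma upper_incomplete_gamma_ge0 u v : 0 <= upper_incomplete_gamma u v.
Proof. by apply: Rintegral_ge0 => x _; exact: gammaw_ge0. Qed.

Lemma cvgy_upper_incomplete_gamma u : 0 < u ->
  upper_incomplete_gamma u x @[x --> +oo] --> 0.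
Proof.
move=> u0; have [C C0 HC] := gamma_tail_le u0.
apply: (squeeze_cvgr (f := cst 0) (h := fun x => C * powR_bump u x)).
- near=> x; rewrite /= upper_incomplete_gamma_ge0 /=.
  have x0 : 0 < x by near: x; apply: nbhs_pinfty_gt; rewrite num_real.
  rewrite -lee_fin /upper_incomplete_gamma /Rintegral fineK; first exact: HC.
  rewrite ge0_fin_numE; first exact: le_lt_trans (HC x x0) (ltry _).
  by apply: integral_ge0 => t _; rewrite lee_fin; exact: gammaw_ge0.
- exact: cvg_cst.
- by rewrite -[X in _ --> X](mulr0 C); apply: cvgM;
    [exact: cvg_cst|exact: cvgy_powR_bump].
Unshelve. all: by end_near. Qed.

(** Continuity up to [v] follows from integrability, so a weight singular at 0 is harmless; the
    derivative comes from the fundamental theorem of calculus at points where the weight is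
    continuous. *)
Lemma gamma_tail_of u v : 0 < u -> 0 <= v ->
  tail_of v (gammaw u) (upper_incomplete_gamma u).
Proof.
move=> u0 v0.
have gi b : mu.-integrable `[v, b] (EFin \o gammaw u).
  apply: integrableS (integrable_gammaw u0) => //.
  by apply: subset_itv; rewrite bnd_simp.
split; last exact: cvgy_upper_incomplete_gamma.
- move=> b vb.
  have cG : {within `[v, b], continuous (fun x => upper_incomplete_gamma u v -
      parameterized_integral mu v x (gammaw u))}.
    move=> x; apply: cvgB; first exact: cvg_cst.
    by apply: parameterized_integral_continuous => //; exact: ltW.
  apply: subspace_eq_continuous cG => x /=.
  rewrite inE /= in_itv /= => /andP[vx _].
  by rewrite /from_subspace (upper_incomplete_gammaE u0 v0 vx).
- move=> x vx; have x0 : 0 < x by exact: le_lt_trans vx.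
  have xx1 : x < x + 1 by rewrite ltrDl.
  have [df fE] := continuous_FTC1_closed xx1 (gi (x + 1)) vx (@continuous_gammaw u x x0).
  have dI : is_derive x 1 (fun y => upper_incomplete_gamma u v -
      \int[mu]_(t in `[v, y]) gammaw u t) (- gammaw u x).
    rewrite -[X in is_derive _ _ _ X]add0r; apply: is_deriveB.
    by apply: DeriveDef; [exact: df|rewrite -derive1E; exact: fE].
  apply: (near_eq_is_derive _ dI).
  near=> y; rewrite -upper_incomplete_gammaE //.
  by apply: ltW; near: y; exact: lt_nbhsr.
Unshelve. all: by end_near. Qed.

End gamma.

(** * Generalised Vandermonde determinants *)

Lemma scalar_powR_lt (R : realType) (n : nat) (l : {scalar 'rV[R]_n})
    (d : 'I_n -> R) (a b : R) : 0 < a -> a < b ->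
  (forall t, a < t < b -> 0 < l (\row_i (d i * t `^ (d i - 1)))) ->
  0 < l (\row_i (b `^ d i - a `^ d i)).
Proof.
move=> a0 ab pos.
have lE (h : 'I_n -> R) : l (\row_i h i) = \sum_i l (delta_mx 0 i) * h i.
  by rewrite scalar_mx_sum big_ord1; apply: eq_bigr => i _; rewrite mxE.
pose F (t : R) := - l (\row_i t `^ d i).
have FE : F = - \sum_i (l (delta_mx 0 i) \*: (@powR R ^~ (d i))).
  by apply/funext => t; rewrite /F lE fctE fct_sumE.
have dF (t : R) : 0 < t -> is_derive t 1 F (- l (\row_i (d i * t `^ (d i - 1)))).
  move=> t0; rewrite FE lE; apply: is_deriveN; apply: is_derive_sum => i.
  apply: is_deriveZ; exact: is_derive1_powR.
have : F b < F a.
  apply: (@decr_off_seq _ _ (fun t => - l (\row_i (d i * t `^ (d i - 1)))) [::]) => //.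
    apply: derivable_within_continuous => t /[!in_itv]/= /andP[at_ _].
    by have [] := dF t (lt_le_trans a0 at_).
  move=> t /[dup]tab /andP[at_ _] _; split; last by rewrite oppr_lt0 pos.
  exact: dF (lt_trans a0 at_).
rewrite ltrN2 -subr_gt0 -linearB /=.
by rewrite (_ : _ - _ = \row_i (b `^ d i - a `^ d i)) //;
  apply/rowP => i; rewrite !mxE.
Qed.

(** Taking partial sums of columns is right multiplication by an upper triangular matrix with unit
    diagonal. *)
Lemma det_mul_trig1 (R : comNzRingType) (n : nat) (M W : 'M[R]_n) :
  (forall i j, M i j = \sum_(k < n | (k <= j)%N) W i k) -> \det M = \det W.
Proof.
move=> ME; pose T : 'M[R]_n := \matrix_(k, j) (k <= j)%N%:R.
have -> : M = W *m T.
  apply/matrixP => i j; rewrite ME !mxE big_mkcond /=.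
  by apply: eq_bigr => k _; rewrite !mxE; case: leqP; rewrite (mulr1, mulr0).
rewrite det_mulmx (_ : \det T = 1) ?mulr1 // -det_tr det_trig.
  by rewrite big1 // => i _; rewrite !mxE leqnn.
by apply/is_trig_mxP => i j ij; rewrite !mxE leqNgt ij.
Qed.

Lemma det_col_scale (R : comNzRingType) (n : nat) (M : 'M[R]_n) (c : 'I_n -> R) :
  \det (\matrix_(i, j) (M i j * c j)) = \det M * \prod_j c j.
Proof.
rewrite (_ : \matrix_(i, j) _ = M *m diag_mx (\row_j c j)).
  by rewrite det_mulmx det_diag; congr (_ * _); apply: eq_bigr => j _; rewrite mxE.
by apply/matrixP => i j; rewrite mul_mx_diag !mxE.
Qed.

Lemma det_row_scale (R : comNzRingType) (n : nat) (M : 'M[R]_n) (c : 'I_n -> R) :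
  \det (\matrix_(i, j) (c i * M i j)) = \prod_j c j * \det M.
Proof.
rewrite -det_tr -[in RHS]det_tr mulrC -det_col_scale; congr (\det _).
by apply/matrixP => i j; rewrite !mxE mulrC.
Qed.

(** Telescoping. Since [0.-1] is 0, column 0 is treated separately; the difference there would
    vanish. *)
Lemma sum_col_differences (R : zmodType) (n : nat) (f : nat -> R) (j : 'I_n) :
  \sum_(k < n | (k <= j)%N) (if k == 0 :> nat then f 0 else f k - f k.-1) = f j.
Proof.
pose g k := if k == 0 then f 0 else f k - f k.-1.
transitivity (\sum_(0 <= k < j.+1) g k).
  rewrite big_mkord (big_ord_widen_cond n xpredT g) //.
elim: (nat_of_ord j) => [|m IH]; first by rewrite big_nat1.
by rewrite big_nat_recr //= IH /g /= addrC subrK.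
Qed.

(** Once the first row consists of ones, differencing adjacent columns leaves a minor of increments
    of powers. The hull argument replaces these by derivatives, which form a smaller matrix of the
    same kind up to row factors. *)
Lemma det_powR_gt0 (R : realType) (n : nat) (c x : 'I_n -> R) :
  (forall i j : 'I_n, (i < j)%N -> c i < c j) ->
  (forall i j : 'I_n, (i < j)%N -> x i < x j) ->
  (forall i, 0 < x i) ->
  0 < \det (\matrix_(i < n, j < n) x j `^ c i).
Proof.
elim: n c x => [c x _ _ _|n IH c x cinc xinc x0]; first by rewrite det_mx00.
pose d i := c (lift ord0 i) - c ord0.
(* Taking the power [c ord0] of [x j] out of column [j] makes the first row constant equal to 1. *)
have -> : \matrix_(i, j) x j `^ c i =
    \matrix_(i, j) ((\matrix_(i, j) x j `^ (c i - c ord0)) i j * x j `^ c ord0).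
  apply/matrixP => i j; rewrite !mxE -powRD ?subrK //.
  by rewrite (gt_eqF (x0 j)) implybT.
rewrite det_col_scale mulr_gt0 ?prodr_gt0 // => [|i _]; last by rewrite powR_gt0.
pose f i (k : nat) := x (inord k) `^ (c i - c ord0).
pose W := \matrix_(i < n.+1, j < n.+1)
  (if j == 0 :> nat then f i 0 else f i j - f i j.-1).
rewrite (@det_mul_trig1 _ _ _ W); last first.
  move=> i j; rewrite mxE -[j in LHS]inord_val -/(f i j) -[LHS]sum_col_differences.
  by apply: eq_bigr => k _; rewrite mxE.
rewrite (expand_det_row _ ord0) big_ord_recl big1 ?addr0; last first.
  by move=> j _; rewrite mxE /= /f subrr !powRr0 subrr mul0r.
rewrite mxE /= /f subrr powRr0 mul1r /cofactor addn0 expr0 mul1r.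
have -> : row' ord0 (col' ord0 W) =
    (\matrix_(j < n) \row_(i < n)
      (x (lift ord0 j) `^ d i - x (widen_ord (leqnSn n) j) `^ d i))^T.
  apply/matrixP => i j; rewrite !mxE /f /d inord_val.
  have -> : inord (lift ord0 j).-1 = widen_ord (leqnSn n) j.
    by apply: val_inj; rewrite /= inordK ?add0n ?leqW.
  by [].
rewrite det_tr.
apply: (@det_rows_hull_gt0 R n (fun t => \row_i (d i * t `^ (d i - 1))) _
  (fun j t => x (widen_ord (leqnSn n) j) < t < x (lift ord0 j))).
  by move=> j l; apply: scalar_powR_lt; rewrite ?xinc.
move=> t tx; have d0 i : 0 < d i by rewrite subr_gt0 cinc.
rewrite -det_tr.
rewrite (_ : _^T = \matrix_(i, j) (d i * (\matrix_(i, j) t j `^ (d i - 1)) i j)).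
  rewrite det_row_scale mulr_gt0 ?prodr_gt0 //; apply: IH => [i j ij|i j ij|i].
  - by rewrite !ltrD2r cinc.
  (* The intervals do not overlap: t_i < x_(i+1) <= x_j < t_j for i < j. *)
  - have /andP[_ +] := tx i; have /andP[+ _] := tx j; move=> h1 h2.
    apply: lt_le_trans h2 (le_trans _ (ltW h1)).
    have [eij|nij] := eqVneq (lift ord0 i) (widen_ord (leqnSn n) j).
      by rewrite eij.
    by apply/ltW/xinc => /=; rewrite ltn_neqAle nij /=.
  - by have /andP[+ _] := tx i; apply: lt_trans.
by apply/matrixP => i j; rewrite !mxE.
Qed.

Lemma det_rev (R : comNzRingType) (n : nat) (M : 'M[R]_n) :
  \det (\matrix_(i, j) M (rev_ord i) (rev_ord j)) = \det M.
Proof.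
pose s := perm (@rev_ord_inj n).
rewrite (_ : \matrix_(i, j) _ = row_perm s (col_perm s M)); last first.
  by apply/matrixP => i j; rewrite !mxE !permE.
rewrite row_permE col_permE !det_mulmx !det_perm odd_permV mulrCA -signr_addb.
by rewrite addbb mulr1.
Qed.

Lemma ltn_rev_ord (n : nat) (i j : 'I_n) : (i < j)%N -> (rev_ord j < rev_ord i)%N.
Proof. by move=> ij; rewrite /= ltn_sub2l // (leq_ltn_trans ij). Qed.

Lemma det_powR_decr_gt0 (R : realType) (n : nat) (c x : 'I_n -> R) :
  (forall i j : 'I_n, (i < j)%N -> c j < c i) ->
  (forall i j : 'I_n, (i < j)%N -> x j < x i) ->
  (forall i, 0 < x i) ->
  0 < \det (\matrix_(i < n, j < n) x j `^ c i).
Proof.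
move=> cdec xdec x0; rewrite -det_rev.
have := @det_powR_gt0 R n (c \o @rev_ord n) (x \o @rev_ord n).
rewrite (_ : \matrix_(i, j) (x \o _) j `^ (c \o _) i = \matrix_(i, j)
   (\matrix_(i, j) x j `^ c i) (rev_ord i) (rev_ord j)); last first.
  by apply/matrixP => i j; rewrite !mxE.
by apply => [i j /ltn_rev_ord /cdec|i j /ltn_rev_ord /xdec|i] //=; exact: x0.
Qed.

Lemma exists_sorting_perm (R : realType) (n : nat) (x : 'I_n -> R) :
  injective x ->
  exists s : 'S_n, forall i j : 'I_n, (i < j)%N -> x (s i) < x (s j).
Proof.
move=> xinj; pose t := [tuple x i | i < n].
have /tuple_permP[s sE] : perm_eq (sort <=%R t) t by rewrite perm_sort.
have st : sorted <%R (sort <=%R t).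
  rewrite lt_sorted_uniq_le sort_uniq sort_le_sorted andbT.
  by rewrite map_inj_uniq ?enum_uniq.
exists s => i j ij; have szt : size (sort <=%R t) = n by rewrite size_sort size_tuple.
have := lt_sorted_ltn_nth 0 st.
move=> /(_ i j); rewrite !inE szt !ltn_ord ij => /(_ isT isT).
by rewrite sE -!tnth_nth !tnth_mktuple.
Qed.

(** The permutation sorting [x] acts on the rows of both determinants, so its sign appears
    squared. *)
Lemma det_powR_mul_gt0 (R : realType) (n : nat) (c u x : 'I_n -> R) :
  (forall i j : 'I_n, (i < j)%N -> c j < c i) ->
  (forall i j : 'I_n, (i < j)%N -> u j < u i) ->
  injective x -> (forall i, 0 < x i) ->
  0 < \det (\matrix_(k < n, i < n) x k `^ c i)
      * \det (\matrix_(k < n, i < n) x k `^ u i).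
Proof.
move=> cdec udec xinj x0.
have Nxinj : injective (fun i => - x i) by move=> i j /oppr_inj /xinj.
have [s sinc] := exists_sorting_perm Nxinj.
have sdec (i j : 'I_n) : (i < j)%N -> x (s j) < x (s i).
  by move=> /sinc; rewrite ltrN2.
have detE (w : 'I_n -> R) : \det (\matrix_(k, i) x k `^ w i) =
    (-1) ^+ s * \det (\matrix_(i, k) x (s k) `^ w i).
  rewrite -[in RHS]det_tr (_ : _^T = row_perm s (\matrix_(k, i) x k `^ w i)).
    by rewrite row_permE det_mulmx det_perm mulrA -expr2 sqrr_sign mul1r.
  by apply/matrixP => i j; rewrite !mxE.
rewrite !detE mulrACA -expr2 sqrr_sign mul1r.
by rewrite mulr_gt0 // det_powR_decr_gt0 // => i; exact: x0.
Qed.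

(** * Total positivity *)

Section total_positivity.
Variable R : realType.
Implicit Types u v : R.

Lemma gammawD (a b x : R) : 0 < x -> gammaw (a + b) x = x `^ a * gammaw b x.
Proof.
move=> x0; rewrite /gammaw -addrA (powRD (r := a)) ?mulrA //.
by apply/implyP => _; rewrite gt_eqF.
Qed.

Lemma upper_incomplete_gamma_gt0 u v : 0 < u -> 0 <= v ->
  0 < upper_incomplete_gamma u v.
Proof.
move=> u0 v0; apply: (tail_of_gt0 (s := [::]) (gamma_tail_of u0 v0)) => // x vx _.
by rewrite gammaw_gt0 // (le_lt_trans v0).
Qed.

(** The matrix of weights is the positive scalar [gammaw 0 x] times the rank one matrix of the
    x^(a_i) x^(b_j), as Andreief's expansion requires. *)
Lemma det_gamma_shift_gt0 (v : R) (r : nat) (a b : 'I_r -> R) : 0 <= v ->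
  decreasing_in [set c : R | 0 < c] a -> decreasing_in [set u : R | 0 < u] b ->
  0 < \det (\matrix_(i, j) upper_incomplete_gamma (a i + b j) v).
Proof.
move=> v0 [/= a0 adec] [/= b0 bdec].
apply: (@andreief_det_gt0 R r (fun i t => t `^ a i) (fun j t => t `^ b j) _
  [set t | v < t]) => [s l pos|x xinj xv].
  have T := tail_of_mx l (fun i j => gamma_tail_of (addr_gt0 (a0 i) (b0 j)) v0).
  apply: (tail_of_gt0 (s := s) T) => // x vx xs.
  have x0 : 0 < x by exact: le_lt_trans vx.
  rewrite (_ : \matrix_(i, j) _ =
      gammaw 0 x *: \matrix_(i, j) (x `^ a i * x `^ b j)).
    by rewrite linearZ /= mulr_gt0 ?gammaw_gt0 ?pos.
  apply/matrixP => i j; rewrite !mxE gammawD // -[b j]addr0 gammawD //.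
  by rewrite addr0 mulrA mulrC.
by apply: det_powR_mul_gt0 => // k; exact: le_lt_trans (xv k).
Qed.

(** Differencing adjacent columns turns the tails into integrals over the disjoint intervals between
    consecutive [b j], the first reaching to infinity. Evaluating the weights at one point of each
    and removing the factor [gammaw u] leaves a Vandermonde matrix. *)
Lemma det_gamma_tail_gt0 (u : R) (r : nat) (a b : 'I_r -> R) : 0 < u -> (0 < r)%N ->
  decreasing_in [set c : R | 0 < c] a -> decreasing_in [set v : R | 0 <= v] b ->
  0 < \det (\matrix_(i, j) upper_incomplete_gamma (a i + u) (b j)).
Proof.
case: r a b => // n a b u0 _ [/= a0 adec] [/= b0 bdec].
pose f i (k : nat) := upper_incomplete_gamma (a i + u) (b (inord k)).
pose W := \matrix_(i < n.+1, j < n.+1)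
  (if j == 0 :> nat then f i 0 else f i j - f i j.-1).
rewrite (@det_mul_trig1 _ _ _ W); last first.
  move=> i j; rewrite mxE -[j in LHS]inord_val -/(f i j) -[LHS]sum_col_differences.
  by apply: eq_bigr => k _; rewrite mxE.
rewrite -det_tr.
have -> : W^T = \matrix_(j < n.+1) \row_(i < n.+1)
    (if j == 0 :> nat then f i 0 else f i j - f i j.-1).
  by apply/matrixP => i j; rewrite !mxE.
apply: (@det_rows_hull_gt0 R n.+1 (fun t => \row_i t `^ a i) _
  (fun j t => b j < t /\ (j != 0 :> nat -> t < b (inord j.-1)))).
  move=> j l pos.
  have T w (w0 : 0 <= w) := tail_of_mx l
    (fun (_ : 'I_1) i => gamma_tail_of (addr_gt0 (a0 i) u0) w0).
  have phi0 x : b j < x -> (j != 0 :> nat -> x < b (inord j.-1)) ->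
      0 < l (\matrix_(_ < 1, i < n.+1) gammaw (a i + u) x).
    move=> bx xb; have x0 : 0 < x by exact: le_lt_trans bx.
    rewrite (_ : \matrix_(_, i) _ = gammaw u x *: \row_i x `^ a i).
      by rewrite linearZ /= mulr_gt0 ?gammaw_gt0 ?pos.
    by apply/matrixP => k i; rewrite !mxE gammawD // mulrC.
  have [j0|j0] := eqVneq (nat_of_ord j) 0.
    have := tail_of_gt0 (s := [::]) (T _ (b0 j)) (lexx _).
    rewrite /f -j0 inord_val; apply => x bx _; apply: phi0 => //.
    by rewrite j0.
  have bj : b j < b (inord j.-1).
    have jn : (j.-1 < n.+1)%N by exact: leq_ltn_trans (leq_pred _) (ltn_ord j).
    by apply: bdec; rewrite inordK // ltn_predL lt0n.
  have := tail_of_decr (s := [::]) (T _ (b0 j)) (lexx _) bj.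
  rewrite -subr_gt0 -linearB /= (_ : _ - _ = \row_i (f i j - f i j.-1)); last first.
    by apply/matrixP => k i; rewrite !mxE /f inord_val.
  by apply => x /andP[bx xb] _; apply: phi0.
move=> t tb; rewrite -det_tr (_ : _^T = \matrix_(i, j) t j `^ a i); last first.
  by apply/matrixP => i j; rewrite !mxE.
apply: det_powR_decr_gt0 => // [i j ij|i]; last first.
  by have [+ _] := tb i; exact: le_lt_trans.
(* For i < j the chain is t_j < b_(j-1) <= b_i < t_i. *)
have [bi _] := tb i; have [_ tj] := tb j.
apply: lt_le_trans (tj _) (le_trans _ (ltW bi)).
  by rewrite -lt0n (leq_ltn_trans _ ij).
have j0 : (0 < j)%N by rewrite (leq_ltn_trans _ ij).
have [->//|ni] := eqVneq (inord j.-1) i.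
apply/ltW/bdec; rewrite inordK ?(leq_ltn_trans (leq_pred _) (ltn_ord j)) //.
rewrite ltn_neqAle -ltnS prednK // ij andbT.
apply: contra_neq ni => <-.
by rewrite inord_val.
Qed.

Lemma gamma_ratio_STP_shift (v : R) : 0 <= v ->
     STP_infty [set c : R | 0 < c] [set u : R | 0 < u]
       (fun c u => gamma_ratio c u v).
Proof.
move=> v0 r a b _ aD bD; have [b0 _] := bD.
rewrite (_ : \matrix_(i, j) _ = \matrix_(i, j)
  ((\matrix_(i, j) upper_incomplete_gamma (a i + b j) v) i j *
    (upper_incomplete_gamma (b j) v)^-1)); last first.
  by apply/matrixP => i j; rewrite !mxE.
rewrite det_col_scale mulr_gt0 ?det_gamma_shift_gt0 //.
by rewrite prodr_gt0 // => j _; rewrite invr_gt0 upper_incomplete_gamma_gt0 ?b0.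
Qed.

Lemma gamma_ratio_STP_tail (u : R) : 0 < u ->
     STP_infty [set c : R | 0 < c] [set v : R | 0 <= v]
       (fun c v => gamma_ratio c u v).
Proof.
move=> u0 r a b r0 aD bD; have [b0 _] := bD.
rewrite (_ : \matrix_(i, j) _ = \matrix_(i, j)
  ((\matrix_(i, j) upper_incomplete_gamma (a i + u) (b j)) i j *
    (upper_incomplete_gamma u (b j))^-1)); last first.
  by apply/matrixP => i j; rewrite !mxE.
rewrite det_col_scale mulr_gt0 ?det_gamma_tail_gt0 //.
by rewrite prodr_gt0 // => j _; rewrite invr_gt0 upper_incomplete_gamma_gt0 ?b0.
Qed.

End total_positivity.

(** * Convexity of the hazard rate *)

Lemma det_mx22 (R : comNzRingType) (M : 'M[R]_2) :
  \det M = M 0 0 * M 1 1 - M 0 1 * M 1 0.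
Proof.
rewrite (expand_det_row _ 0) !big_ord_recl big_ord0 addr0 /cofactor !det_mx11.
rewrite !mxE /= expr0 expr1 mul1r mulN1r mulrN.
by congr (_ * M _ _ - M _ _ * M _ _); apply: val_inj.
Qed.

Section reverse_rule.
Variable R : realType.
Implicit Types a c d u v x : R.
Local Notation G := (@upper_incomplete_gamma R).

Lemma mulr_gammaw a x : 0 < a -> 0 <= x -> x * gammaw a x = x `^ a * expR (- x).
Proof. by move=> a0 x0; rewrite /gammaw mulrA mulr_powRB1. Qed.

Lemma is_derive_upper_incomplete_gamma a x : 0 < a -> 0 < x ->
  is_derive x 1 (G a) (- gammaw a x).
Proof. by move=> a0 x0; have [_ + _] := gamma_tail_of a0 (lexx 0); apply. Qed.

(** The difference is the tail at [v] of the weight (x^c - v^c) [gammaw a x], with v^c held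
    constant. *)
Lemma powR_gamma_lt a c v : 0 < a -> 0 < c -> 0 < v ->
  v `^ c * G a v < G (c + a) v.
Proof.
move=> a0 c0 v0; have T := tail_ofD (gamma_tail_of (addr_gt0 c0 a0) (ltW v0))
  (tail_ofZ (- v `^ c) (gamma_tail_of a0 (ltW v0))).
rewrite -subr_gt0 -mulNr; apply: (tail_of_gt0 (s := [::]) T) => // x vx _.
have x0 := lt_trans v0 vx.
rewrite gammawD // -mulrDl; apply: mulr_gt0; last exact: gammaw_gt0.
by rewrite subr_gt0; apply: gt0_ltr_powR => //; rewrite nnegrE ltW.
Qed.

Lemma cvgy_powR_gamma a c : 0 < a -> 0 < c -> x `^ c * G a x @[x --> +oo] --> 0.
Proof.
move=> a0 c0.
apply: (squeeze_cvgr (f := cst 0) (h := fun x => G (c + a) x)).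
- near=> x; have x0 : 0 < x by near: x; apply: nbhs_pinfty_gt; rewrite num_real.
  by rewrite /= mulr_ge0 ?powR_ge0 ?upper_incomplete_gamma_ge0 //= ltW // powR_gamma_lt.
- exact: cvg_cst.
- exact/cvgy_upper_incomplete_gamma/addr_gt0.
Unshelve. all: by end_near. Qed.

Lemma cvgy_powR_expRN a : 0 < a -> x `^ a * expR (- x) @[x --> +oo] --> 0.
Proof.
move=> a0; have [C C0 HC] := powR_sqr_le_expR a0.
apply: (squeeze_cvgr (f := cst 0) (h := fun x => C * powR_bump a x)).
- near=> x; have x0 : 0 < x by near: x; apply: nbhs_pinfty_gt; rewrite num_real.
  rewrite /= mulr_ge0 ?powR_ge0 ?expR_ge0 //= expRN.
  have p0 : 0 < 1 + x `^ a by rewrite ltr_pwDl ?ltr01 // powR_ge0.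
  rewrite /powR_bump ler_pdivrMr ?expR_gt0 // mulrAC ler_pdivlMr //.
  apply: le_trans (HC x x0).
  by rewrite expr2 ler_wpM2r ?(ltW p0) // lerDr ler01.
- exact: cvg_cst.
- by rewrite -[X in _ --> X](mulr0 C); apply: cvgM;
    [exact: cvg_cst|exact: cvgy_powR_bump].
Unshelve. all: by end_near. Qed.

Lemma is_derive_expRN x : is_derive x 1 (fun y : R => expR (- y)) (- expR (- x)).
Proof.
have H := @is_derive1_comp R expR -%R x _ _ (is_derive_expR _) (is_deriveNid _ _).
by rewrite -mulrN1.
Qed.

(** The right side minus the left is the integral of [G a] from [v] to infinity; [F] is that
    integral in closed form. *)
Lemma gamma_hazard_lt a v : 0 < a -> 0 < v ->
  (v - a) * G a v < v `^ a * expR (- v).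
Proof.
move=> a0 v0.
pose F := fun x => x `^ a * expR (- x) + a * G a x - x `^ 1 * G a x.
have T : tail_of v (G a) F.
  apply: tail_of_open => [x vx|].
    have x0 : 0 < x by exact: lt_le_trans vx.
    have d1 := is_deriveM (is_derive1_powR a x0) (is_derive_expRN x).
    have dG := is_derive_upper_incomplete_gamma a0 x0.
    have d2 := is_deriveM (is_derive1_powR 1 x0) dG.
    have d3 := is_deriveZ a dG.
    have d := is_deriveB (is_deriveD d1 d3) d2.
    apply: is_derive_eq.
    rewrite /GRing.scale /= subrr powRr0 powRr1 ?(ltW x0) // mulrN.
    rewrite -mulr_gammaw ?(ltW x0) // /gammaw.
    ring.
  rewrite -[X in _ --> X]subr0 -[X in _ --> X - _]addr0 -[X in _ --> _ + X - _](mulr0 a).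
  apply: cvgB; last exact: cvgy_powR_gamma.
  apply: cvgD; first exact: cvgy_powR_expRN.
  by apply: cvgM; [exact: cvg_cst|exact: cvgy_upper_incomplete_gamma].
have := tail_of_gt0 (s := [::]) T (lexx v); rewrite /F powRr1 ?(ltW v0) //.
have F0 x : v < x -> x \notin [::] -> 0 < G a x.
  by move=> vx _; rewrite upper_incomplete_gamma_gt0 // ltW // (lt_trans v0).
move=> /(_ F0); lra.
Qed.

(** For [x > 0], the reciprocal of [x] times the hazard rate [gammaw a x / G a x], written as a
    product for ease of differentiation. *)
Definition mills a x : R := G a x * (x `^ (- a) * expR x).

(** Up to a positive factor the derivative is (t - a) G a t - t^a exp(-t), negative by
    [gamma_hazard_lt]. *)
Lemma mills_decr a x y : 0 < a -> 0 < x -> x < y -> mills a y < mills a x.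
Proof.
move=> a0 x0 xy.
pose df t := G a t * (t `^ (- a) * expR t + expR t * (- a * t `^ (- a - 1)))
  + (t `^ (- a) * expR t) * (- gammaw a t).
have dM (t : R) : 0 < t -> is_derive t 1 (mills a) (df t).
  move=> t0.
  have d1 := is_deriveM (is_derive1_powR (- a) t0) (is_derive_expR t).
  exact: is_deriveM (is_derive_upper_incomplete_gamma a0 t0) d1.
apply: (@decr_off_seq _ _ df [::]) => //.
  apply: derivable_within_continuous => t /[!in_itv]/= /andP[xt _].
  by have [] := dM t (lt_le_trans x0 xt).
move=> t /andP[xt _] _; have t0 := lt_trans x0 xt.
split; first exact: dM.
have tE : t `^ (- a) = t * t `^ (- a - 1).
  by rewrite -[X in X * _](powRr1 (ltW t0)) -powRD ?subrKC // (gt_eqF t0) implybT.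
have -> : df t = t `^ (- a - 1) * expR t * ((t - a) * G a t - t * gammaw a t).
  by rewrite /df tE; ring.
rewrite pmulr_rlt0 ?mulr_gt0 ?powR_gt0 ?expR_gt0 // subr_lt0 mulr_gammaw ?(ltW t0) //.
exact: gamma_hazard_lt.
Qed.

(** The integral of (t^c - x^c) [gammaw a t] over t > x. Its ratio to [G (c + a) x] is 1 minus the
    quotient of the hazard rates at [c + a] and [a]. *)
Definition gamma_gap a c x : R := G (c + a) x - x `^ c * G a x.

Lemma gamma_gap_tail_of a c v : 0 < a -> 0 < c -> 0 < v ->
  tail_of v (fun x => c * x `^ (c - 1) * G a x) (gamma_gap a c).
Proof.
move=> a0 c0 v0; apply: tail_of_open => [x vx|].
  have x0 : 0 < x by exact: lt_le_trans vx.
  have dG := is_derive_upper_incomplete_gamma a0 x0.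
  have dG' := is_derive_upper_incomplete_gamma (addr_gt0 c0 a0) x0.
  have d := is_deriveB dG' (is_deriveM (is_derive1_powR c x0) dG).
  apply: is_derive_eq.
  by rewrite /GRing.scale /= gammawD //; ring.
rewrite -[X in _ --> X]subr0; apply: cvgB; last exact: cvgy_powR_gamma.
exact/cvgy_upper_incomplete_gamma/addr_gt0.
Qed.

(** Since [G a x] is [mills a x] times [x * gammaw a x], the side with exponent e is the mean of
    [mills a] over x > v for the weight [gammaw (e + a)]. A larger exponent favours large x, where
    [mills a] is smaller. *)
Lemma gamma_gap_ratio_decr a c d v : 0 < a -> 0 < c -> c < d -> 0 < v ->
  gamma_gap a d v / G (d + a) v / d < gamma_gap a c v / G (c + a) v / c.
Proof.
move=> a0 c0 cd v0; have d0 := lt_trans c0 cd.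
have Gc0 : 0 < G (c + a) v by rewrite upper_incomplete_gamma_gt0 ?addr_gt0 // ltW.
have Gd0 : 0 < G (d + a) v by rewrite upper_incomplete_gamma_gt0 ?addr_gt0 // ltW.
have [k k0 kGc] : exists2 k, 0 < k & k * G (c + a) v = G (d + a) v.
  exists (G (d + a) v / G (c + a) v); first exact: divr_gt0 Gd0 Gc0.
  by rewrite (divfK (lt0r_neq0 Gc0)).
have e0 : 0 < d - c by rewrite subr_gt0.
(* [x0 ^ (d - c)] is the mean of [x ^ (d - c)] for the weight [gammaw (c + a)],
   which cancels the last tail in [T]; moreover the two factors of the
   weight [(x ^ (d - c) - x0 ^ (d - c)) * (mills a x0 - mills a x)] change sign
   at the same point. *)
pose x0 := k `^ (d - c)^-1.
have x00 : 0 < x0 by rewrite powR_gt0.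
have x0e : x0 `^ (d - c) = k.
  by rewrite /x0 -powRrM mulVf ?gt_eqF // powRr1 // ltW.
have T := tail_ofD
  (tail_ofD (tail_ofZ (k / c) (gamma_gap_tail_of a0 c0 v0))
     (tail_ofZ (- d^-1) (gamma_gap_tail_of a0 d0 v0)))
  (tail_ofZ (mills a x0) (tail_ofD (gamma_tail_of (addr_gt0 d0 a0) (ltW v0))
     (tail_ofZ (- k) (gamma_tail_of (addr_gt0 c0 a0) (ltW v0))))).
have := tail_of_gt0 (s := [:: x0]) T (lexx v).
set P := (X in (X -> _) -> _).
suff HP : P.
  move=> /(_ HP).
  rewrite (_ : _ + - k * _ = 0); last by rewrite mulNr kGc subrr.
  rewrite mulr0 addr0 mulNr subr_gt0 => H.
  have alg (x y B : R) : 0 < B -> d^-1 * x < k / c * y ->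
      x / (k * B) / d < y / B / c.
    move=> B0; have kB0 : 0 < (k * B)^-1 by rewrite invr_gt0 mulr_gt0.
    rewrite -(ltr_pM2r kB0).
    have -> : d^-1 * x * (k * B)^-1 = x / (k * B) / d by rewrite -mulrA mulrC.
    by have -> : k / c * y * (k * B)^-1 = y / B / c by field; rewrite !gt_eqF.
  by rewrite -kGc; apply: alg.
move=> x vx; rewrite inE => xx0.
have xp := lt_trans v0 vx.
have GE : G a x = mills a x * (x * gammaw a x).
  rewrite /mills (mulr_gammaw a0 (ltW xp)) expRN powRN.
  field.
  by rewrite !gt_eqF ?expR_gt0 ?powR_gt0.
have xcE y : x `^ (y - 1) * x = x `^ y.
  rewrite -[X in _ * X](powRr1 (ltW xp)) -powRD ?subrK //.
  by apply/implyP => _; rewrite gt_eqF.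
have xdE : x `^ d = x `^ (d - c) * x `^ c.
  rewrite -powRD ?subrK //.
  by apply/implyP => _; rewrite gt_eqF.
rewrite !gammawD // GE.
rewrite [ltRHS](_ : _ = x `^ c * gammaw a x *
    ((x `^ (d - c) - k) * (mills a x0 - mills a x))).
  have w0 : 0 < x `^ c * gammaw a x.
    by apply: mulr_gt0; [exact: powR_gt0|exact: gammaw_gt0].
  rewrite (pmulr_rgt0 _ w0) -x0e.
  have [xlt|xgt|xE] := ltgtP x x0; last by rewrite xE eqxx in xx0.
    rewrite nmulr_rgt0 subr_lt0; first exact: mills_decr.
    by apply: gt0_ltr_powR => //; rewrite nnegrE ltW.
  rewrite pmulr_rgt0 subr_gt0; first exact: mills_decr.
  by apply: gt0_ltr_powR => //; rewrite nnegrE ltW.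
rewrite -[in RHS]xcE.
have -> : k / c * (c * x `^ (c - 1) * (mills a x * (x * gammaw a x))) =
   k * x `^ c * mills a x * gammaw a x.
  by rewrite -[in RHS]xcE; field; rewrite gt_eqF.
have -> : - d^-1 * (d * x `^ (d - 1) * (mills a x * (x * gammaw a x))) =
   - (x `^ d * mills a x * gammaw a x).
  by rewrite -[in RHS]xcE; field; rewrite gt_eqF.
by rewrite xcE xdE; ring.
Qed.

(** As [K e / e] decreases in [e], [K] is strictly subadditive; expressing [K] through hazard rates
    turns this into the claim, up to a positive factor. *)
Lemma gamma_hazard_convex a c d v : 0 < a -> 0 < c -> 0 < d -> 0 < v ->
  gammaw (c + a) v / G (c + a) v + gammaw (d + a) v / G (d + a) v <
  gammaw a v / G a v + gammaw (c + d + a) v / G (c + d + a) v.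
Proof.
have alg (p q r s : R) : 0 < p ->
    1 - q / p < 1 - r / p + (1 - s / p) -> r + s < p + q.
  move=> p0; rewrite -(ltr_pM2r p0) !mulrDl !mulNr !divfK ?gt_eqF //; lra.
move=> a0 c0 d0 v0; have s0 := addr_gt0 c0 d0.
have G0 u : 0 < u -> 0 < G u v.
  by move=> u0; rewrite upper_incomplete_gamma_gt0 // ltW.
have Ga := G0 _ a0; have Gc := G0 _ (addr_gt0 c0 a0).
have Gd := G0 _ (addr_gt0 d0 a0); have Gs := G0 _ (addr_gt0 s0 a0).
have ga := gammaw_gt0 a v0.
pose K e := gamma_gap a e v / G (e + a) v.
have Ks : K (c + d) < K c + K d.
  have lin k x y z w : 0 < x -> 0 < y -> k / (x + y) < z / x ->
      k / (x + y) < w / y -> k < z + w.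
    move=> x0 y0; rewrite (ltr_pdivlMr _ _ x0) (ltr_pdivlMr _ _ y0) => H1 H2.
    have := ltrD H1 H2.
    by rewrite -mulrDr divfK // gt_eqF // addr_gt0.
  apply: (lin _ c d) => //; apply: gamma_gap_ratio_decr => //.
    by rewrite ltrDl.
  by rewrite ltrDr.
have KE e : 0 < G (e + a) v ->
    K e = 1 - (gammaw (e + a) v / G (e + a) v) / (gammaw a v / G a v).
  have gap_alg (p g A E : R) : 0 < g -> 0 < A -> 0 < E ->
      (E - p * A) / E = 1 - (p * g / E) / (g / A).
    by move=> g0 A0 E0; field; rewrite !gt_eqF.
  by move=> Ge; rewrite gammawD //; exact: gap_alg.
move: Ks; rewrite (KE _ Gc) (KE _ Gd) (KE _ Gs); apply: alg.
exact: divr_gt0 ga Ga.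
Qed.

(** * The reverse rule of order 2 *)

Lemma gamma_ratio_SRR2 c : 0 < c ->
  SRR 2 [set u : R | 0 < u] [set v : R | 0 <= v] (fun u v => gamma_ratio c u v).
Proof.
move=> c0 r a b r12 [/= a0 adec] [/= b0 bdec].
have Rgt0 u v : 0 < u -> 0 <= v -> 0 < gamma_ratio c u v.
  by move=> u0 v0; rewrite divr_gt0 ?upper_incomplete_gamma_gt0 ?addr_gt0.
have lnR u v : 0 < u -> 0 <= v ->
    ln (gamma_ratio c u v) = ln (G (c + u) v) - ln (G u v).
  by move=> u0 v0; rewrite ln_div ?posrE ?upper_incomplete_gamma_gt0 ?addr_gt0.
case: r a b r12 a0 adec b0 bdec => [|[|[|//]]] // a b _ a0 adec b0 bdec.
  by rewrite subnn muln0 div0n expr0 mul1r det_mx11 mxE Rgt0.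
rewrite divnn /= expr1 mulN1r oppr_gt0 det_mx22 !mxE subr_lt0.
have a01 : a 1 < a 0 by exact: adec.
have b01 : b 1 < b 0 by exact: bdec.
set u1 := a 0 in a01 *; set u2 := a 1 in a01 *.
set v1 := b 0 in b01 *; set v2 := b 1 in b01 *.
have u20 : 0 < u2 by exact: a0. have u10 : 0 < u1 by exact: a0.
have v20 : 0 <= v2 by exact: b0. have v10 : 0 <= v1 by exact: b0.
have Rpos u v : 0 < u -> 0 <= v -> gamma_ratio c u v \in Num.pos.
  by move=> u0 v0; rewrite posrE; exact: Rgt0.
have R11 := Rpos u1 v1 u10 v10; have R22 := Rpos u2 v2 u20 v20.
have R12 := Rpos u1 v2 u10 v20; have R21 := Rpos u2 v1 u20 v10.
rewrite -(ltr_ln (rpredM R11 R22) (rpredM R12 R21)) (lnM R11 R22) (lnM R12 R21).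
(* [L v] is the logarithm of [gamma_ratio c u1 v / gamma_ratio c u2 v], which has to be smaller at
   [v1] than at [v2]. *)
pose L v := ln (G (c + u1) v) + ln (G u2 v) - (ln (G (c + u2) v) + ln (G u1 v)).
have alg (p q r s p' q' r' s' x11 x22 x12 x21 : R) :
    x11 = p - q -> x22 = r' - s' -> x12 = p' - q' -> x21 = r - s ->
    p + s - (r + q) < p' + s' - (r' + q') -> x11 + x22 < x12 + x21.
  by move=> -> -> -> ->; lra.
suff Llt : L v1 < L v2.
  exact: alg (lnR _ _ u10 v10) (lnR _ _ u20 v20) (lnR _ _ u10 v20)
    (lnR _ _ u20 v10) Llt.
pose h u v := gammaw u v / G u v.
pose df v := - h (c + u1) v + - h u2 v - (- h (c + u2) v + - h u1 v).
have dq u v : 0 < u -> 0 < v -> is_derive v 1 (fun v => ln (G u v)) (- h u v).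
  move=> u0 v0; have G0 : 0 < G u v by rewrite upper_incomplete_gamma_gt0 // ltW.
  have := is_derive1_comp (is_derive1_ln G0) (is_derive_upper_incomplete_gamma u0 v0).
  by rewrite mulrN mulrC.
(* [v2] may be 0, where [dq] does not apply, so continuity up to the endpoints is proved on its
   own. *)
have cq u : 0 < u -> {within `[v2, v1], continuous (fun v => ln (G u v))}.
  move=> u0; have [+ _ _] := gamma_tail_of u0 v20 => /(_ v1 b01).
  have lnc x : 0 <= x -> {for G u x, continuous (@ln R)}.
    by move=> x0; apply: continuous_ln; exact: upper_incomplete_gamma_gt0.
  move=> /(continuous_within_itvP _ b01)[Gc Gl Gr].
  apply/(continuous_within_itvP _ b01); split=> [x xb||].
  - apply: continuous_comp; first exact: Gc.
    by apply: lnc; move: xb; rewrite in_itv/= => /andP[/ltW /(le_trans v20)].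
  - by apply: (cvg_comp _ _ Gl); exact: lnc.
  - by apply: (cvg_comp _ _ Gr); exact: lnc.
apply: (@decr_off_seq _ L df [::]) => //.
  by move=> x; apply: cvgB; apply: cvgD; apply: cq; rewrite ?addr_gt0.
move=> v /andP[v2v _] _; have v0 : 0 < v by exact: le_lt_trans v2v.
split.
  by apply: is_deriveB; apply: is_deriveD; apply: dq; rewrite ?addr_gt0.
(* The second difference of the hazard rate is based at [u2], with steps [c] and [u1 - u2]. *)
have cE : c + (u1 - u2) + u2 = c + u1 by rewrite -addrA subrK.
have := gamma_hazard_convex u20 c0 (_ : 0 < u1 - u2) v0.
rewrite subr_gt0 => /(_ a01); rewrite cE subrK => hconv.
have signs (p q r s : R) : r + s < q + p -> - p + - q - (- r + - s) < 0.
  by clear; lra.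
exact: signs hconv.
Qed.

End reverse_rule.

Theorem proposition4p1 (R : realType) :
  (forall v : R, 0 <= v ->
     STP_infty [set c : R | 0 < c] [set u : R | 0 < u]
       (fun c u => gamma_ratio c u v)) /\
  (forall u : R, 0 < u ->
     STP_infty [set c : R | 0 < c] [set v : R | 0 <= v]
       (fun c v => gamma_ratio c u v)) /\
  (forall c : R, 0 < c ->
     SRR 2 [set u : R | 0 < u] [set v : R | 0 <= v]
       (fun u v => gamma_ratio c u v)).
Proof.
split; first exact: gamma_ratio_STP_shift.
split; first exact: gamma_ratio_STP_tail.
exact: gamma_ratio_SRR2.
Qed.
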